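(* For every $n\ge1$, on the monoid $\mathcal{DORP}_n$ we have $\mathcal{D}^*=\mathcal{J}^*$.
   Context: Let $[n]=\{1,\dots,n\}$ with its usual order. A partial transformation of $[n]$ is a function $\rho$ whose domain $\mathrm{Dom}\,\rho$ and image $\mathrm{Im}\,\rho$ are subsets of $[n]$ (the empty map is allowed). Maps are written on the right and composed left to right: $x(\rho\sigma)=(x\rho)\sigma$. $\rho$ is isotone if $x\le y$ implies $x\rho\le y\rho$ for all $x,y\in\mathrm{Dom}\,\rho$; antitone if $x\le y$ implies $x\rho\ge y\rho$; monotone if isotone or antitone; decreasing if $x\rho\le x$ for all $x\in\mathrm{Dom}\,\rho$. $\mathcal{DORP}_n$ is the monoid, under composition, of all monotone and decreasing partial transformations of $[n]$. On a semigroup $S$, $\mathcal{L}^*=\{(a,b)\in S\times S:\ \forall x,y\in S^1,\ ax=ay\iff bx=by\}$, $\mathcal{R}^*=\{(a,b)\in S\times S:\ \forall x,y\in S^1,\ xa=ya\iff xb=yb\}$, and $\mathcal{D}^*$ is the join of $\mathcal{L}^*$ and $\mathcal{R}^*$ in the lattice of equivalence relations. Write $L^*_a$, $R^*_a$ for the $\mathcal{L}^*$- and $\mathcal{R}^*$-classes of $a$. A left (resp. right) $*$-ideal of $S$ is a left (resp. right) ideal $I$ of $S$ such that $L^*_a\subseteq I$ (resp. $R^*_a\subseteq I$) for all $a\in I$; a $*$-ideal is a subset that is both a left and a right $*$-ideal. $J^*(a)$ is the intersection of all $*$-ideals of $S$ containing $a$, and $a\,\mathcal{J}^*\,b$ iff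 $J^*(a)=J^*(b)$. *)

(* Defs.v *)
From Stdlib Require Import RelationClasses.
From HB Require Import structures.
From mathcomp Require Import all_boot.

Set Implicit Arguments.
Unset Strict Implicit.
Unset Printing Implicit Defensive.

Local Open Scope group_scope.

Section StarRelations.
Variable S : monoidType.
Implicit Types (a b x y : S) (I : S -> Prop).

(* As S has an identity, S^1 = S: the quantifiers over S^1 range over S. *)
Definition Lstar a b : Prop := forall x y, a * x = a * y <-> b * x = b * y.
Definition Rstar a b : Prop := forall x y, x * a = y * a <-> x * b = y * b.

Definition left_ideal I : Prop := forall s a, I a -> I (s * a).
Definition right_ideal I : Prop := forall s a, I a -> I (a * s).

Definition left_star_ideal I : Prop :=
  left_ideal I /\ forall a, I a -> forall b, Lstar a b -> I b.
Definition right_star_ideal I : Prop :=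
  right_ideal I /\ forall a, I a -> forall b, Rstar a b -> I b.
Definition star_ideal I : Prop := left_star_ideal I /\ right_star_ideal I.

(* Whether the empty set counts as an ideal does not matter here, since only  *)
(* the *-ideals containing [a] are intersected.                               *)
Definition Jstar_ideal a : S -> Prop :=
  fun x => forall I, star_ideal I -> I a -> I x.

Definition Jstar a b : Prop := forall x, Jstar_ideal a x <-> Jstar_ideal b x.

End StarRelations.

(* Least upper bound of two relations among the equivalence relations on T,   *)
(* i.e. the intersection of all equivalence relations containing both.        *)
Definition equiv_join (T : Type) (R1 R2 : T -> T -> Prop) (a b : T) : Prop :=
  forall E : T -> T -> Prop, Equivalence E ->
    (forall x y, R1 x y -> E x y) -> (forall x y, R2 x y -> E x y) -> E a b.

Definition Dstar (S : monoidType) : S -> S -> Prop :=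
  equiv_join (@Lstar S) (@Rstar S).

(* The chain 1 < ... < n is represented by 'I_n, i.e. by 0 < ... < n.-1.      *)
(* A partial transformation is a total map into option: [f x = None] means    *)
(* that [x] is outside the domain, [f x = Some u] that [u] is the image of x. *)
Definition ptrans (n : nat) : Type := {ffun 'I_n -> option 'I_n}.

HB.instance Definition _ (n : nat) := Finite.on (ptrans n).

Section PartialTransformations.
Variable n : nat.
Implicit Types f g : ptrans n.

(* Maps act on the right: x (f g) = (x f) g. *)
Definition pt_mul f g : ptrans n := [ffun x => obind g (f x)].
Definition pt_one : ptrans n := [ffun x => Some x].

Lemma pt_mulA : associative pt_mul.
Proof.
by move=> f g h; apply/ffunP=> x; rewrite !ffunE; case: (f x) => //= y; rewrite ffunE.
Qed.

Lemma pt_mul1g : left_id pt_one pt_mul.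
Proof. by move=> f; apply/ffunP=> x; rewrite !ffunE. Qed.

Lemma pt_mulg1 : right_id pt_one pt_mul.
Proof.
by move=> f; apply/ffunP=> x; rewrite !ffunE; case: (f x) => //= y; rewrite ffunE.
Qed.

Definition isotone f : bool :=
  [forall x, forall y, forall u, forall v,
    [&& f x == Some u, f y == Some v & x <= y] ==> (u <= v)]%N.

Definition antitone f : bool :=
  [forall x, forall y, forall u, forall v,
    [&& f x == Some u, f y == Some v & x <= y] ==> (u >= v)]%N.

Definition monotone f : bool := isotone f || antitone f.

Definition decreasing f : bool :=
  [forall x, forall u, (f x == Some u) ==> (u <= x)%N].

Definition dorp_pred : {pred ptrans n} := [pred f | monotone f && decreasing f].

Lemma isotoneP f :
  reflect (forall x y u v : 'I_n, f x = Some u -> f y = Some v ->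
             (x <= y)%N -> (u <= v)%N) (isotone f).
Proof.
apply: (iffP 'forall_'forall_'forall_'forall_implyP) => H x y u v.
  by move=> fx fy xy; apply: (H x y); rewrite fx fy xy !eqxx.
by case/and3P=> /eqP fx /eqP fy; apply: H.
Qed.

Lemma antitoneP f :
  reflect (forall x y u v : 'I_n, f x = Some u -> f y = Some v ->
             (x <= y)%N -> (v <= u)%N) (antitone f).
Proof.
apply: (iffP 'forall_'forall_'forall_'forall_implyP) => H x y u v.
  by move=> fx fy xy; apply: (H x y); rewrite fx fy xy !eqxx.
by case/and3P=> /eqP fx /eqP fy; apply: H.
Qed.

Lemma decreasingP f :
  reflect (forall x u : 'I_n, f x = Some u -> (u <= x)%N) (decreasing f).
Proof.
apply: (iffP 'forall_'forall_implyP) => H x u; first by move/eqP; apply: H.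
by move/eqP; apply: H.
Qed.

Lemma pt_mulP f g (x w : 'I_n) :
  pt_mul f g x = Some w -> exists2 u, f x = Some u & g u = Some w.
Proof. by rewrite ffunE; case: (f x) => //= u; exists u. Qed.

Lemma monotone_mul f g : monotone f -> monotone g -> monotone (pt_mul f g).
Proof.
case/orP=> [/isotoneP mf|/antitoneP mf] /orP[/isotoneP mg|/antitoneP mg];
  apply/orP.
- left; apply/isotoneP=> x y w z /pt_mulP[u fx gu] /pt_mulP[v fy gv] xy.
  by apply: (mg u v) => //; apply: (mf x y).
- right; apply/antitoneP=> x y w z /pt_mulP[u fx gu] /pt_mulP[v fy gv] xy.
  by apply: (mg u v) => //; apply: (mf x y).
- right; apply/antitoneP=> x y w z /pt_mulP[u fx gu] /pt_mulP[v fy gv] xy.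
  by apply: (mg v u) => //; apply: (mf x y).
- left; apply/isotoneP=> x y w z /pt_mulP[u fx gu] /pt_mulP[v fy gv] xy.
  by apply: (mg v u) => //; apply: (mf x y).
Qed.

Lemma decreasing_mul f g : decreasing f -> decreasing g -> decreasing (pt_mul f g).
Proof.
move=> /decreasingP df /decreasingP dg; apply/decreasingP=> x w.
by case/pt_mulP=> u /df ux /dg wu; apply: leq_trans ux.
Qed.

Lemma dorp_pred1 : pt_one \in dorp_pred.
Proof.
rewrite inE; apply/andP; split.
  by apply/orP; left; apply/isotoneP=> x y u v; rewrite !ffunE => -[<-] [<-].
by apply/decreasingP=> x u; rewrite ffunE => -[<-].
Qed.

End PartialTransformations.

HB.instance Definition _ (n : nat) := isSemigroup.Build (ptrans n) (@pt_mulA n).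
HB.instance Definition _ (n : nat) :=
  Semigroup_isMonoid.Build (ptrans n) (@pt_mul1g n) (@pt_mulg1 n).

Lemma dorp_umagma_closed (n : nat) : umagma_closed (@dorp_pred n).
Proof.
split=> [|f g]; first exact: dorp_pred1.
rewrite !inE => /andP[mf df] /andP[mg dg].
by apply/andP; split; [exact: monotone_mul | exact: decreasing_mul].
Qed.

Record DORP (n : nat) : Type := Dorp {
  dorp_val :> ptrans n;
  dorp_valP : dorp_val \in @dorp_pred n
}.

HB.instance Definition _ (n : nat) := [isSub for @dorp_val n].
HB.instance Definition _ (n : nat) := [Finite of DORP n by <:].
HB.instance Definition _ (n : nat) :=
  SubChoice_isSubMonoid.Build (ptrans n) (@dorp_pred n) (DORP n)
    (@dorp_umagma_closed n).

(* Main.v *)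
(* A partial map is treated as the map [obind f] on [option 'I_n] fixing      *)
(* [None].  Restricted identities and maps defined only at the top point show *)
(* that L*-related elements have the same image and R*-related elements the   *)
(* same kernel, hence both have the same rank; so "rank at most r" is a       *)
(* *-ideal, and J*-related elements have equal rank.  Conversely, list the    *)
(* image of [a] upwards if [a] is isotone and downwards if it is antitone;    *)
(* replacing each value by its position gives an isotone map with the kernel  *)
(* of [a] and an initial segment as image, and an isotone map onto an initial *)
(* segment is decreasing.  Thus elements of equal rank are linked by a chain  *)
(* R*, L*, R*.                                                                *)
Require Import Defs.
From mathcomp Require Import all_boot.

Set Implicit Arguments.
Unset Strict Implicit.
Unset Printing Implicit Defensive.

Local Open Scope group_scope.

(** In any monoid [Dstar] is contained in [Jstar] ([Dstar_Jstar]), since [Jstar] is an equivalence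
    and star ideals are closed under both generating relations. For the converse, [LstarP] and
    [Rstar_ker] make rank an invariant of both, so rank bounds cut out star ideals and [Jstar_card]
    follows. By [Rstar_initial] each [Rstar]-class has a member whose image depends on the rank
    alone, which yields [card_Dstar]. *)

Section StarIdeals.
Variable S : monoidType.
Implicit Types a b : S.

Lemma Lstar_sym a b : Lstar a b -> Lstar b a.
Proof. by move=> H x y; split=> /H. Qed.

Lemma Rstar_sym a b : Rstar a b -> Rstar b a.
Proof. by move=> H x y; split=> /H. Qed.

Lemma Dstar_Jstar a b : Dstar a b -> Jstar a b.
Proof.
apply.
- by split=> [x y|x y H z|x y z H1 H2 t]; [|split=> /H|split=> [/H1/H2|/H2/H1]].
- move=> x y H z; split=> Hz I sI Iw; apply: (Hz) => //.
    by apply: sI.1.2 Iw _ (Lstar_sym H).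
  by apply: sI.1.2 Iw _ H.
- move=> x y H z; split=> Hz I sI Iw; apply: (Hz) => //.
    by apply: sI.2.2 Iw _ (Rstar_sym H).
  by apply: sI.2.2 Iw _ H.
Qed.

End StarIdeals.

(** * Images and rank of partial maps, read on pointed sets *)

Section PointedImage.
Variable n : nat.
Implicit Types f g : ptrans n.

(* [None] always belongs to [pimage f], so its cardinal is the rank plus one. *)
Definition pimage f : {set option 'I_n} := [set obind f o | o : option 'I_n].

Lemma obind_mul f g o : obind (pt_mul f g) o = obind g (obind f o).
Proof. by case: o => //= x; rewrite ffunE. Qed.

Lemma ptrans_obindP f g : f = g <-> forall o, obind f o = obind g o.
Proof. by split=> [->//|H]; apply/ffunP=> x; apply: (H (Some x)). Qed.

Lemma pimage_mul f g : pimage (pt_mul f g) = obind g @: pimage f.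
Proof.
by rewrite /pimage -imset_comp; apply: eq_imset => o; apply: obind_mul.
Qed.

Lemma pimage_mul_sub f g : pimage (pt_mul f g) \subset pimage g.
Proof.
by rewrite pimage_mul; apply/subsetP=> _ /imsetP[o _ ->]; apply: imset_f.
Qed.

Lemma card_pimage_mull f g : #|pimage (pt_mul f g)| <= #|pimage f|.
Proof. by rewrite pimage_mul leq_imset_card. Qed.

(** [g] factors through [f]: choosing a preimage under [f] and then applying [g] maps [pimage f]
    onto [pimage g]. *)
Lemma card_pimage_ker f g :
  (forall o p, obind f o = obind f p -> obind g o = obind g p) ->
  #|pimage g| <= #|pimage f|.
Proof.
move=> fg; pose h q := obind g (odflt None [pick o | obind f o == q]).
suff ->: pimage g = h @: pimage f by apply: leq_imset_card.
rewrite /pimage -imset_comp; apply: eq_imset => o /=; rewrite /h.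
by case: pickP => [p /eqP/fg //|/(_ o)]; rewrite eqxx.
Qed.

End PointedImage.

(** * [Lstar] as equality of images, [Rstar] as equality of kernels *)

Section StarRelationsDORP.
Variable n : nat.
Implicit Types a b c : DORP n.

Definition restr_id (A : {set option 'I_n}) : ptrans n :=
  [ffun x => if Some x \in A then Some x else None].

Lemma restr_id_dorp A : restr_id A \in @dorp_pred n.
Proof.
have idE x u : restr_id A x = Some u -> x = u.
  by rewrite ffunE; case: ifP => // _ [].
rewrite inE; apply/andP; split; last by apply/decreasingP=> x u /idE->.
by apply/orP; left; apply/isotoneP=> x y u v /idE-> /idE->.
Qed.

(** Right multiplication by the identity restricted to the image of [a] fixes [a], hence [b]. *)
Lemma Lstar_pimage_sub a b : Lstar a b -> pimage b \subset pimage a.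
Proof.
move=> ab; pose e : DORP n := Dorp (restr_id_dorp (pimage a)).
have /ab : a * e = a * 1.
  rewrite mulg1; apply/val_inj/ptrans_obindP=> o.
  rewrite [LHS]obind_mul.
  have: obind (dorp_val a) o \in pimage a by apply: imset_f.
  by case: (obind (dorp_val a) o) => //= u ua; rewrite ffunE ua.
rewrite mulg1 => <-; apply: subset_trans (pimage_mul_sub _ _) _.
apply/subsetP=> _ /imsetP[o _ ->].
have None_a: None \in pimage a by apply/imsetP; exists None.
by case: o => //= u; rewrite ffunE; case: ifP.
Qed.

Lemma LstarP a b : Lstar a b <-> pimage a = pimage b.
Proof.
split=> [ab|ab].
  by apply/eqP; rewrite eqEsubset !Lstar_pimage_sub //; apply: Lstar_sym.
have mulE c x y : c * x = c * y <->
    {in pimage c, obind (dorp_val x) =1 obind (dorp_val y)}.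
  split=> [/(congr1 val)/ptrans_obindP H _ /imsetP[o _ ->]|H].
    by rewrite -!obind_mul; apply: H.
  apply/val_inj/ptrans_obindP=> o; rewrite [LHS]obind_mul [RHS]obind_mul.
  by apply: H; apply: imset_f.
by move=> x y; split=> /mulE H; apply/mulE; move: H; rewrite ab.
Qed.

Definition at_pt (z : 'I_n) (o : option 'I_n) : ptrans n :=
  [ffun t => if t == z then o else None].

Lemma at_pt_dorp (z : 'I_n) o :
  (forall x : 'I_n, x <= z) -> at_pt z o \in @dorp_pred n.
Proof.
have atE x u : at_pt z o x = Some u -> x = z /\ o = Some u.
  by rewrite ffunE; case: eqP.
move=> zmax; rewrite inE; apply/andP; split.
  apply/orP; left; apply/isotoneP=> x y u v /atE[_ ou] /atE[_].
  by rewrite ou => -[->].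
by apply/decreasingP=> x u /atE[-> _].
Qed.

(** A map defined only at the top point may take any value there and still be decreasing, so
    multiplying it by [a] evaluates [a] at an arbitrary [o]. *)
Lemma Rstar_ker a b : Rstar a b ->
  forall o p, obind (dorp_val a) o = obind (dorp_val a) p ->
    obind (dorp_val b) o = obind (dorp_val b) p.
Proof.
move=> ab o p aop.
(* Without a top point ['I_n] is empty, and both [o] and [p] are [None]. *)
have [z zmax|noz] := pickP [pred z : 'I_n | [forall x : 'I_n, x <= z]];
  last first.
  have n0 (x : 'I_n) : False.
    have n_gt0: 0 < n by apply: leq_ltn_trans (ltn_ord x).
    have ltn: n.-1 < n by rewrite prednK.
    case/negP: (negbT (noz (Ordinal ltn))); apply/forallP=> y /=.
    by rewrite -ltnS prednK.
  by case: o p {aop} => [x|] [y|] //; case: (n0 x); case: (n0 y).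
move/forallP in zmax.
pose e q : DORP n := Dorp (at_pt_dorp q zmax).
have eE c q : dorp_val (e q * c) z = obind (dorp_val c) q.
  by rewrite !ffunE eqxx.
have /ab/(congr1 (fun c : DORP n => dorp_val c z)) : e o * a = e p * a.
  apply/val_inj/ffunP=> t; have [->|tz] := eqVneq t z; first by rewrite !eE.
  by rewrite !ffunE (negbTE tz).
by rewrite !eE.
Qed.

(** As [o] and [p] may be [None], this kernel also records the domain. *)
Lemma ker_Rstar a b :
  (forall o p, obind (dorp_val a) o = obind (dorp_val a) p <->
     obind (dorp_val b) o = obind (dorp_val b) p) ->
  Rstar a b.
Proof.
have mulE c x y : x * c = y * c <->
    forall o, obind (dorp_val c) (obind (dorp_val x) o) =
      obind (dorp_val c) (obind (dorp_val y) o).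
  split=> [/(congr1 val)/ptrans_obindP H o|H].
    by rewrite -!obind_mul; apply: H.
  by apply/val_inj/ptrans_obindP=> o; rewrite [LHS]obind_mul [RHS]obind_mul.
by move=> ab x y; split=> /mulE H; apply/mulE => o; apply/ab.
Qed.

(** * Rank as an invariant of [Jstar] *)

Lemma Rstar_card a b : Rstar a b -> #|pimage a| = #|pimage b|.
Proof.
move=> ab; apply/eqP; rewrite eqn_leq.
by rewrite !card_pimage_ker //; apply: Rstar_ker => //; apply: Rstar_sym.
Qed.

Lemma star_ideal_card r : star_ideal (fun a : DORP n => #|pimage a| <= r).
Proof.
split; split=> [s a ar|a ar b ab].
- exact: leq_trans (subset_leq_card (pimage_mul_sub _ _)) ar.
- by rewrite -(iffLR (LstarP a b) ab).
- exact: leq_trans (card_pimage_mull _ _) ar.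
- by rewrite -(Rstar_card ab).
Qed.

Lemma Jstar_card a b : Jstar a b -> #|pimage a| = #|pimage b|.
Proof.
move=> ab; apply/eqP; rewrite eqn_leq; apply/andP; split.
  by apply: (iffLR (ab a) _ _ (star_ideal_card _)) => // I _.
by apply: (iffRL (ab b) _ _ (star_ideal_card _)) => // I _.
Qed.

(** * Representatives whose image is an initial segment *)

Lemma sorted_enum_ord (A : {set 'I_n}) : sorted (relpre val ltn) (enum A).
Proof.
rewrite /enum_mem; apply: sorted_filter.
  by move=> x y z; apply: ltn_trans.
by rewrite -sorted_map -enumT val_enum_ord iota_ltn_sorted.
Qed.

Lemma image_listing a : exists s : seq 'I_n,
  [/\ uniq s, forall u, (u \in s) = (Some u \in pimage a) &
      forall x y u v : 'I_n, dorp_val a x = Some u -> dorp_val a y = Some v ->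
        x <= y -> index u s <= index v s].
Proof.
pose A := [set u | Some u \in pimage a].
have inA x u : dorp_val a x = Some u -> u \in A.
  by move=> ax; rewrite inE; apply/imsetP; exists (Some x).
have: monotone a by have := dorp_valP a; rewrite inE => /andP[].
case/orP=> [/isotoneP am|/antitoneP am].
  exists (enum A); split=> [|u|x y u v ax ay xy].
  - exact: enum_uniq.
  - by rewrite mem_enum inE.
  (* Contrapositive: in a sorted list a smaller position means a smaller value. *)
  have := am _ _ _ _ ax ay xy; apply: contraLR; rewrite -!ltnNge.
  apply: (sorted_ltn_index _ (sorted_enum_ord A)).
  - by move=> ? ? ?; apply: ltn_trans.
  - by rewrite mem_enum; apply: inA ay.
  - by rewrite mem_enum; apply: inA ax.
exists (rev (enum A)); split=> [|u|x y u v ax ay xy].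
- by rewrite rev_uniq enum_uniq.
- by rewrite mem_rev mem_enum inE.
have := am _ _ _ _ ax ay xy; apply: contraLR; rewrite -!ltnNge.
apply: (@sorted_ltn_index _ (fun u v : 'I_n => v < u)).
- by move=> ? ? ? /[swap]; apply: ltn_trans.
- by rewrite rev_sorted; apply: sorted_enum_ord.
- by rewrite mem_rev mem_enum; apply: inA ay.
- by rewrite mem_rev mem_enum; apply: inA ax.
Qed.

Definition pinitial (r : nat) : {set option 'I_n} :=
  [set o : option 'I_n | if o is Some u then u < r else true].

Lemma isotone_initial_decreasing (f : ptrans n) r :
  isotone f -> pimage f = pinitial r -> decreasing f.
Proof.
move=> /isotoneP fi fr; apply/decreasingP=> x u fx.
have ur: u < r.
  have: Some u \in pimage f by apply/imsetP; exists (Some x).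
  by rewrite fr inE.
have card_le (z : 'I_n) : #|[set t : 'I_n | t <= z]| = z.+1.
  rewrite cardE -(size_map val) -[RHS](size_iota 0).
  apply/perm_size/uniq_perm; rewrite ?iota_uniq ?map_inj_uniq ?enum_uniq //.
    exact: val_inj.
  move=> k; rewrite mem_iota ltnS /=; apply/mapP/idP => [[t]|kz].
    by rewrite mem_enum inE => tz ->.
  by exists (Ordinal (leq_ltn_trans kz (ltn_ord z))); rewrite // mem_enum inE.
(* All values up to [u = f x] are attained, necessarily at points up to [x]. *)
rewrite -ltnS -(card_le u) -(card_le x).
rewrite -(card_imset _ (@Some_inj _)).
apply: leq_trans (leq_imset_card f _).
apply/subset_leq_card/subsetP=> _ /imsetP[v + ->]; rewrite inE => vu.
have: Some v \in pimage f by rewrite fr inE (leq_ltn_trans vu).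
case/imsetP=> -[y|] // _ /= fy.
(* If [v] is attained beyond [x], isotonicity forces [v = u], which is attained at [x] itself. *)
have [yx|/ltnW xy] := leqP y x; first by rewrite fy imset_f // inE.
have uv: u = v.
  by apply: val_inj; apply/eqP; rewrite eqn_leq vu (fi _ _ _ _ fx (esym fy) xy).
by rewrite -uv -fx imset_f // inE.
Qed.

(** The relabelling [phi] itself need not be decreasing when [a] is antitone; only its composite
    with [a] has to be. *)
Lemma Rstar_initial a :
  exists2 c : DORP n, Rstar a c & pimage c = pinitial #|pimage a|.-1.
Proof.
have [s [s_uniq sE s_mono]] := image_listing a.
have None_a: None \in pimage a by apply/imsetP; exists None.
have cardE: #|pimage a|.-1 = size s.
  have <-: #|None :: map Some s|.-1 = #|pimage a|.-1.
    congr _.-1; apply: eq_card => -[u|]; rewrite inE //=.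
    by rewrite mem_map ?sE //; apply: Some_inj.
  have us: uniq (None :: map Some s).
    rewrite /= map_inj_uniq ?s_uniq ?andbT; last exact: Some_inj.
    by apply/mapP=> -[].
  by rewrite (card_uniqP us) /= size_map.
have size_n: size s <= n.
  by rewrite -(card_uniqP s_uniq) -[leqRHS]card_ord max_card.
(* On [s] the value is never [None], because positions stay below [size s <= n]; so the domain of
   [a] is kept. *)
pose phi v : option 'I_n := insub (index v s).
have phiP v : v \in s -> exists2 u : 'I_n, phi v = Some u & val u = index v s.
  rewrite -index_mem => vs; rewrite /phi.
  by case: insubP => [u _ uE|/negP[]]; [exists u | apply: leq_trans size_n].
pose f : ptrans n := [ffun x => obind phi (dorp_val a x)].
have fE o : obind f o = obind phi (obind (dorp_val a) o).
  by case: o => //= x; rewrite ffunE.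
have f_im: pimage f = pinitial (size s).
  apply/setP=> o; rewrite inE; apply/imsetP/idP=> [[p _ ->]|].
    rewrite fE; have: obind (dorp_val a) p \in pimage a by apply: imset_f.
    case: (obind (dorp_val a) p) => //= v; rewrite -sE => vs.
    by have [u -> ->] := phiP v vs; rewrite index_mem.
  case: o => [u us|_]; last by exists None.
  have vs: nth u s u \in s by rewrite mem_nth.
  have: Some (nth u s u) \in pimage a by rewrite -sE.
  case/imsetP=> p _ ap; exists p => //; rewrite fE -ap /=.
  have [w -> wE] := phiP _ vs; congr Some; apply: val_inj.
  by rewrite wE index_uniq.
have a_s x u : dorp_val a x = Some u -> u \in s.
  by move=> ax; rewrite sE; apply/imsetP; exists (Some x).
have f_iso: isotone f.
  apply/isotoneP=> x y u v; rewrite !ffunE.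
  case ax: (dorp_val a x) => [u'|] //=; case ay: (dorp_val a y) => [v'|] //=.
  have [w -> wE] := phiP _ (a_s _ _ ax); have [t -> tE] := phiP _ (a_s _ _ ay).
  by move=> [<-] [<-] xy; rewrite wE tE (s_mono x y).
have f_dorp: f \in @dorp_pred n.
  rewrite inE; apply/andP; split; first by rewrite /monotone f_iso.
  exact: isotone_initial_decreasing f_iso f_im.
exists (Dorp f_dorp); last by rewrite cardE.
apply: ker_Rstar => o p /=; rewrite !fE; split=> [->//|].
have: obind (dorp_val a) o \in pimage a by apply: imset_f.
have: obind (dorp_val a) p \in pimage a by apply: imset_f.
case: (obind (dorp_val a) o) (obind (dorp_val a) p)
  => [u|] [v|] //=; rewrite -?sE.
- move=> vs us; have [w -> wE] := phiP _ us; have [t -> tE] := phiP _ vs.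
  case=> wt; congr Some; rewrite -(nth_index u us) -(nth_index u vs).
  by rewrite -wE -tE wt.
- by move=> _ us; have [w ->] := phiP _ us.
- by move=> vs _; have [w ->] := phiP _ vs.
Qed.

Lemma card_Dstar a b : #|pimage a| = #|pimage b| -> Dstar a b.
Proof.
move=> ab E Eeq LE RE.
have [c /RE ac cE] := Rstar_initial a; have [d /RE bd dE] := Rstar_initial b.
have /LE cd : Lstar c d by apply/LstarP; rewrite cE dE ab.
by transitivity (c : DORP n); last (transitivity (d : DORP n); last symmetry).
Qed.

End StarRelationsDORP.

Theorem lemma2p17 (n : nat) (n_ge1 : (1 <= n)%N) (a b : DORP n) :
  Dstar a b <-> Jstar a b.
Proof. by split=> [/Dstar_Jstar|/Jstar_card/card_Dstar]. Qed.
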